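(* Let $\{x^k\}$ be an infinite sequence of points produced by the algorithm AS-ZSL described in the context, where for every index pair $(i,j)$ with $i\neq j$ selected by Strategy MVP (i.e. $(i,j)=(\hat\imath,\hat\jmath)$) or by Strategy AC2CD (i.e. $(i,j)=(p^k_h,j(k))$) the function $f$ is required to be strictly convex along the directions $\pm(e_i-e_j)$. Then $\{x^k\}$ has limit points, and every limit point of $\{x^k\}$ is an optimal solution of the problem $\min\{f(x) : x\in\mathbb{R}^n,\ e^Tx=0\}$.
   Context: Problem: given $A\in\mathbb{R}^{m\times n}$, $y\in\mathbb{R}^m$, $\lambda\in\mathbb{R}$ with $\lambda\ge 0$, consider $\min f(x)$ subject to $e^Tx=\sum_{i=1}^n x_i=0$, where $f(x)=\varphi(x)+\lambda\|x\|_1$, $\varphi(x)=\frac12\|Ax-y\|^2$, $e$ is the all-ones vector and $e_i$ is the $i$th unit vector. A point $x$ is feasible if $e^Tx=0$. Here $\operatorname{sign}(0)=0$. Strict convexity of $f$ along $\pm(e_i-e_j)$ means that $\xi\mapsto f(x+\xi(e_i-e_j))$ is strictly convex on $\mathbb{R}$ for every feasible $x$; for $i\ne j$ this holds if and only if the $i$th and $j$th columns of $A$ are different, and it can be guaranteed without loss of generality by fixing $x_i=0$ and removing this variable whenever two identical columns $i$ and $j$ of $A$ are found. Multiplier function: fix $p>0$; for $x\neq 0$ let $\mu(x)=\dfrac{\sum_{i=1}^n|x_i|^p(\nabla_i\varphi(x)+\lambda\operatorname{sign}(x_i))}{\sum_{i=1}^n|x_i|^p}$. Active-set estimate: given $x^k$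 and a vector $\pi^k\in\mathbb{R}^n$, let $\mathcal A^k=\{i : x^k_i=0,\ |\pi^k_i|\le\lambda\}$ and $\mathcal N^k=\{1,\dots,n\}\setminus\mathcal A^k$. Algorithm AS-ZSL, with parameters $\theta\in(0,1]$, $\tau\in(0,1]$. Set $x^0=0$. If $x^0$ is optimal, stop. Otherwise compute a feasible $x^1$ with $f(x^1)<f(x^0)$ and, at iteration $k=1$, use Strategy MVP. For $k\ge 2$, as long as $x^k$ is not optimal: if $\frac{f(x^{k-1})-f(x^k)}{\max\{f(x^{k-1}),1\}}\le\theta$ and Strategy MVP was not used at iteration $k-1$, use Strategy MVP at iteration $k$; otherwise use Strategy AC2CD at iteration $k$. An infinite sequence is produced if the algorithm never stops at an optimal point. Strategy MVP at $x^k$: set $\pi^k=\nabla\varphi(x^k)-\mu(x^k)e$ and compute $\mathcal A^k,\mathcal N^k$; choose $\hat\imath\in\operatorname{Argmin}_{i\in\mathcal N^k}\{\nabla_i\varphi(x^k)+(2\min\{\operatorname{sign}(x^k_i),0\}+1)\lambda\}$ and $\hat\jmath\in\operatorname{Argmax}_{j\in\mathcal N^k}\{\nabla_j\varphi(x^k)+(2\max\{\operatorname{sign}(x^k_j),0\}-1)\lambda\}$; set $x^{k+1}=x^k+\xi^*(e_{\hat\imath}-e_{\hat\jmath})$ with $\xi^*\in\operatorname{Argmin}_{\xi\in\mathbb{R}}f(x^k+\xi(e_{\hat\imath}-e_{\hat\jmath}))$. Strategy AC2CD at $x^k$: set $\pi^k=\pi^{k-1}$ and compute $\mathcal A^k,\mathcal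 N^k$; choose an index $j(k)\in\mathcal N^k$ with $|x^k_{j(k)}|\ge\tau\|x^k\|_\infty$; set $z^{k,1}=x^k$; choose a permutation $p^k_1,\dots,p^k_{|\mathcal N^k|}$ of $\mathcal N^k$; for $i=1,\dots,|\mathcal N^k|$ set $z^{k,i+1}=z^{k,i}+\xi^*(e_{p^k_i}-e_{j(k)})$ with $\xi^*\in\operatorname{Argmin}_{\xi\in\mathbb{R}}f(z^{k,i}+\xi(e_{p^k_i}-e_{j(k)}))$ (if $p^k_i=j(k)$ then $z^{k,i+1}=z^{k,i}$); set $x^{k+1}=z^{k,|\mathcal N^k|+1}$. *)

(* Defs.v *)
From HB Require Import structures.
From mathcomp Require Import all_boot all_order all_algebra.
From mathcomp Require Import all_classical all_reals all_analysis.

Set Implicit Arguments.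
Unset Strict Implicit.
Unset Printing Implicit Defensive.

Import Order.TTheory GRing.Theory Num.Theory.
Import numFieldNormedType.Exports.

Local Open Scope classical_set_scope.
Local Open Scope ring_scope.

(* MathComp-Analysis, over an arbitrary model R of the real numbers.  R^n is
   'cV[R]_n; its library norm `|x| is the max norm, and its topology is the
   usual one. *)

Section Problem.
Context {R : realType} {m n : nat}.
Implicit Types (A : 'M[R]_(m, n)) (y : 'cV[R]_m) (lam p tau : R).
Implicit Types (x u pi : 'cV[R]_n) (i j : 'I_n).

Definition unit_vec i : 'cV[R]_n := delta_mx i 0.

Definition pair_dir i j : 'cV[R]_n := unit_vec i - unit_vec j.

(* The squared norm here is Euclidean, unlike `|A *m x - y| ^+ 2. *)
Definition phi A y x : R := 2^-1 * \sum_(r < m) ((A *m x - y) r 0) ^+ 2.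

Definition norm1 x : R := \sum_(i < n) `|x i 0|.

Definition objective A y lam x : R := phi A y x + lam * norm1 x.

Definition grad_phi A y x : 'cV[R]_n := \col_i 'D_(unit_vec i) (phi A y) x.

Definition feasible x : Prop := \sum_(i < n) x i 0 = 0.

Definition optimal A y lam x : Prop :=
  feasible x /\
  forall u, feasible u -> objective A y lam x <= objective A y lam u.

Definition strictly_convex (g : R -> R) : Prop :=
  forall a b t, a != b -> 0 < t < 1 ->
    g (t * a + (1 - t) * b) < t * g a + (1 - t) * g b.

Definition strictly_convex_along A y lam i j : Prop :=
  forall x, feasible x ->
    strictly_convex (fun xi => objective A y lam (x + xi *: pair_dir i j)).

(* Only meaningful for x != 0; the value at 0 is 0 because 0^-1 = 0. *)
Definition multiplier A y lam p x : R :=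
  (\sum_(i < n) `|x i 0| `^ p * (grad_phi A y x i 0 + lam * Num.sg (x i 0)))
  / \sum_(i < n) `|x i 0| `^ p.

Definition active lam x pi : {set 'I_n} :=
  [set i | (x i 0 == 0) && (`|pi i 0| <= lam)]%SET.

Definition nonactive lam x pi : {set 'I_n} := (~: active lam x pi)%SET.

Definition mvp_pi A y lam p x : 'cV[R]_n :=
  \col_i (grad_phi A y x i 0 - multiplier A y lam p x).

(* u' is obtained from u by an exact line search along e_i - e_j; when i = j
   the direction is 0 and this says u' = u. *)
Definition line_search A y lam i j u u' : Prop :=
  exists xi : R,
    (forall xi' : R, objective A y lam (u + xi *: pair_dir i j)
                     <= objective A y lam (u + xi' *: pair_dir i j)) /\
    u' = u + xi *: pair_dir i j.

Definition mvp_up A y lam x i : R :=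
  grad_phi A y x i 0 + (2 * Num.min (Num.sg (x i 0)) 0 + 1) * lam.

Definition mvp_down A y lam x j : R :=
  grad_phi A y x j 0 + (2 * Num.max (Num.sg (x j 0)) 0 - 1) * lam.

Definition mvp_step A y lam p x pi i j x' : Prop :=
  let N := nonactive lam x pi in
  [/\ pi = mvp_pi A y lam p x,
      i \in N /\ (forall h, h \in N ->
        mvp_up A y lam x i <= mvp_up A y lam x h),
      j \in N /\ (forall h, h \in N ->
        mvp_down A y lam x h <= mvp_down A y lam x j)
    & line_search A y lam i j x x'].

(* u' is reached from u by successive line searches along e_i - e_j, for i
   running through s in order. *)
Fixpoint sweep A y lam j (s : seq 'I_n) u u' : Prop :=
  if s is i :: s' then
    exists z, line_search A y lam i j u z /\ sweep A y lam j s' z u'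
  else u' = u.

Definition ac2cd_step A y lam tau x pi_prev pi j (s : seq 'I_n) x' : Prop :=
  let N := nonactive lam x pi in
  [/\ pi = pi_prev,
      j \in N /\ tau * `|x| <= `|x j 0|,
      perm_eq s (enum N)
    & sweep A y lam j s x x'].

End Problem.

(* The data generated by the algorithm.  At iteration k, ihat and jhat are
   relevant only if Strategy MVP is used, and pivot and pivot_order only if Strategy
   AC2CD is used; the values at other iterations are arbitrary, as are all
   values at k = 0 except that of pt. *)
Record trace (R : realType) (n : nat) := Trace {
  pt : nat -> 'cV[R]_n;
  mult_est : nat -> 'cV[R]_n;
  uses_mvp : nat -> bool;
  ihat : nat -> 'I_n;
  jhat : nat -> 'I_n;
  pivot : nat -> 'I_n;
  pivot_order : nat -> seq 'I_n
}.

Section Algorithm.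
Context {R : realType} {m n : nat}.
Implicit Types (A : 'M[R]_(m, n)) (y : 'cV[R]_m) (lam p theta tau : R).
Implicit Types (T : trace R n).

Record AS_ZSL_run A y lam p theta tau T : Prop := {
  run_pt0 : pt T 0 = 0;
  run_nonoptimal0 : ~ optimal A y lam (pt T 0);
  run_pt1 : feasible (pt T 1);
  run_pt1_lt : objective A y lam (pt T 1) < objective A y lam (pt T 0);
  run_mvp1 : uses_mvp T 1;
  (* optimality is not tested at iteration 1 *)
  run_nonoptimal : forall k, ~ optimal A y lam (pt T k.+2);
  run_choice : forall k, uses_mvp T k.+2 =
    ((objective A y lam (pt T k.+1) - objective A y lam (pt T k.+2))
       / Num.max (objective A y lam (pt T k.+1)) 1 <= theta)
    && ~~ uses_mvp T k.+1;
  run_mvp : forall k, (0 < k)%N -> uses_mvp T k ->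
    mvp_step A y lam p (pt T k) (mult_est T k) (ihat T k) (jhat T k)
      (pt T k.+1);
  run_ac2cd : forall k, (0 < k)%N -> ~~ uses_mvp T k ->
    ac2cd_step A y lam tau (pt T k) (mult_est T k.-1) (mult_est T k)
      (pivot T k) (pivot_order T k) (pt T k.+1)
}.

Definition selected_pair T i j : Prop :=
  exists2 k, (0 < k)%N &
    if uses_mvp T k then i = ihat T k /\ j = jhat T k
    else i \in pivot_order T k /\ j = pivot T k.

End Algorithm.

(* Main.v *)
(* The objective decreases along the run, and each exact line search along a
   direction of positive curvature displaces the iterate by O(sqrt(decrease)),
   so consecutive iterates get close; eventually the relative decrease is below
   theta, so the two strategies alternate.  Along an ultrafilter containing the
   MVP iterations k, both x^k and x^(k+1) tend to a point x*, and the AC2CD sweep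
   at k+1 shows that x* is stationary along e_i - e_j for the limit pivot j and
   all i outside the active set.  This identifies mu(x* ) with the multiplier at
   the pivot, and the active-set test, computed at x^k, yields the remaining
   optimality conditions.  All limit points share the objective value of x*.

   Boundedness is immediate if lam > 0.  If lam = 0 the level sets may be
   unbounded; then the MVP step is greedy over all indices, so it contracts the
   objective gap by a fixed factor and the displacements are summable. *)
Require Import Defs.
From HB Require Import structures.
From mathcomp Require Import all_boot all_order all_algebra.
From mathcomp Require Import all_classical all_reals all_analysis.
From mathcomp Require Import ring lra.
Set Implicit Arguments.
Unset Strict Implicit.
Import Order.TTheory GRing.Theory Num.Theory.
Import numFieldNormedType.Exports.
Local Open Scope classical_set_scope.
Local Open Scope ring_scope.

Lemma cvg_sumr {R : realType} {I : finType} {U : Type} (F : set_system U)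
    (f : I -> U -> R) (l : I -> R) : Filter F ->
  (forall i, f i u @[u --> F] --> l i) ->
  \sum_i f i u @[u --> F] --> \sum_i l i.
Proof.
by move=> FF fl; apply: cvg_big => //; apply: add_continuous.
Qed.

Lemma cvg_expr2 {R : realType} {U : Type} (F : set_system U) (f : U -> R) (l : R) :
  Filter F -> f u @[u --> F] --> l -> f u ^+ 2 @[u --> F] --> l ^+ 2.
Proof. by move=> FF fl; rewrite expr2; apply: cvgM. Qed.

(** * Second-order expansion, gradient and continuity of the objective *)

Section QuadraticPart.
Context {R : realType} {m n : nat}.
Implicit Types (A : 'M[R]_(m, n)) (y : 'cV[R]_m) (x h : 'cV[R]_n) (i j : 'I_n) (lam : R).

Definition sqnorm {k} (v : 'cV[R]_k) : R := \sum_(r < k) v r 0 ^+ 2.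

(** Closed form of the gradient of [phi], used in all computations; [grad_phiE] identifies it with
    the directional derivatives in [grad_phi]. *)
Definition gradient A y x : 'cV[R]_n := A^T *m (A *m x - y).

(** The constant second derivative of [phi] along [pair_dir i j]. *)
Definition curvature A i j : R := sqnorm (A *m pair_dir i j).

Lemma sqnorm_ge0 k (v : 'cV[R]_k) : 0 <= sqnorm v.
Proof. by apply: sumr_ge0 => r _; apply: sqr_ge0. Qed.

Lemma sqnorm_eq0 k (v : 'cV[R]_k) : sqnorm v = 0 -> v = 0.
Proof.
move=> v0; apply/matrixP => r c; rewrite ord1 mxE; apply/eqP.
move/eqP: v0; rewrite psumr_eq0; last by move=> ? _; apply: sqr_ge0.
by move=> /allP /(_ r (mem_index_enum r)); rewrite sqrf_eq0.
Qed.

Lemma sqnormZ k a (v : 'cV[R]_k) : sqnorm (a *: v) = a ^+ 2 * sqnorm v.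
Proof.
by rewrite /sqnorm mulr_sumr; apply: eq_bigr => r _; rewrite mxE exprMn.
Qed.

Lemma phi_expand A y x h : phi A y (x + h) =
  phi A y x + \sum_i gradient A y x i 0 * h i 0 + 2^-1 * sqnorm (A *m h).
Proof.
have -> : \sum_i gradient A y x i 0 * h i 0 =
    \sum_r (A *m x - y) r 0 * (A *m h) r 0.
  under eq_bigr => i _ do rewrite [gradient _ _ _ _ _]mxE mulr_suml.
  rewrite exchange_big; apply: eq_bigr => r _.
  have -> : (A *m h) r 0 = \sum_i A r i * h i 0 by rewrite mxE.
  rewrite mulr_sumr.
  by apply: eq_bigr => i _; rewrite [A^T i r]mxE; ring.
rewrite /phi mulmxDr addrAC [_ - y + _ in LHS]addrC.
under eq_bigr => r _.
  rewrite mxE (_ : _ ^+ 2 = (A *m x - y) r 0 ^+ 2 +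
    2 * ((A *m x - y) r 0 * (A *m h) r 0) + (A *m h) r 0 ^+ 2); last by ring.
  over.
rewrite !big_split /= -mulr_sumr /sqnorm.
by field.
Qed.

Lemma pair_dirE i j k : (pair_dir i j : 'cV[R]_n) k 0 = (k == i)%:R - (k == j)%:R.
Proof. by rewrite !mxE !eqxx !andbT. Qed.

Lemma pair_dir_id i : (pair_dir i i : 'cV[R]_n) = 0.
Proof. exact: subrr. Qed.

Lemma sum_unit (a : 'I_n -> R) i : \sum_k a k * (k == i)%:R = a i.
Proof.
rewrite (bigD1 i) //= eqxx mulr1 big1 ?addr0 // => k /negPf ->.
by rewrite mulr0.
Qed.

Lemma sum_pair_dir (a : 'I_n -> R) i j :
  \sum_k a k * (pair_dir i j : 'cV[R]_n) k 0 = a i - a j.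
Proof.
under eq_bigr => k _ do rewrite pair_dirE mulrBr.
by rewrite sumrB !sum_unit.
Qed.

Lemma feasible_line x i j xi :
  feasible x -> feasible (x + xi *: (pair_dir i j : 'cV[R]_n)).
Proof.
rewrite /feasible => x0.
under eq_bigr => k _ do rewrite mxE [X in _ + X]mxE.
rewrite big_split /= x0 add0r -{1}[xi]mulr1.
by have := sum_pair_dir (fun=> xi) i j; rewrite subrr mulr1.
Qed.

Lemma phi_line A y x i j xi : phi A y (x + xi *: pair_dir i j) =
  phi A y x + xi * (gradient A y x i 0 - gradient A y x j 0)
  + 2^-1 * xi ^+ 2 * curvature A i j.
Proof.
rewrite phi_expand -scalemxAr sqnormZ -/(curvature A i j) [2^-1 * (_ * _)]mulrA.
rewrite -(sum_pair_dir (fun k => gradient A y x k 0)) mulr_sumr.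
congr (_ + _ + _); apply: eq_bigr => k _.
by rewrite [X in _ * X = _]mxE; ring.
Qed.

Lemma grad_phiE A y x : grad_phi A y x = gradient A y x.
Proof.
apply/matrixP => i c; rewrite ord1 mxE /derive.
apply: cvg_lim => //.
pose q := 2^-1 * sqnorm (A *m unit_vec i).
have lim : (gradient A y x i 0 + h * q) @[h --> (0 : R)^'] --> gradient A y x i 0.
  rewrite -[X in _ --> X]addr0; apply: cvgD; first exact: cvg_cst.
  rewrite -[X in _ --> X](mul0r q); apply: cvgM; last exact: cvg_cst.
  exact: nbhs_dnbhs.
apply: cvg_trans lim; apply: near_eq_cvg.
near=> h.
have h0 : h != 0 by near: h; exact: nbhs_dnbhs_neq.
rewrite /= [_ + x]addrC phi_expand -scalemxAr sqnormZ.
have -> : \sum_k gradient A y x k 0 * (h *: unit_vec i : 'cV[R]_n) k 0 =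
    h * gradient A y x i 0.
  rewrite -(sum_unit (fun k => gradient A y x k 0)) mulr_sumr.
  by apply: eq_bigr => k _; rewrite !mxE eqxx andbT; ring.
rewrite /q /GRing.scale /=; field.
exact: h0.
Unshelve. all: by end_near. Qed.

(** * Continuity along an arbitrary filter: neighbourhoods and ultrafilters of indices both occur *)

Section Continuity.
Context {U : Type} (F : set_system U) {FF : Filter F}.
Context (u : U -> 'cV[R]_n) (x : 'cV[R]_n).
Context (cvu : forall i, u k i 0 @[k --> F] --> x i 0).

Lemma cvg_residual A y r : (A *m u k - y) r 0 @[k --> F] --> (A *m x - y) r 0.
Proof.
have E z : (A *m z - y) r 0 = \sum_i A r i * z i 0 - y r 0 by rewrite !mxE.
under eq_fun do rewrite E.
rewrite E; apply: cvgB; last exact: cvg_cst.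
by apply: cvg_sumr => i; apply: cvgM => //; exact: cvg_cst.
Qed.

Lemma cvg_gradient A y i : gradient A y (u k) i 0 @[k --> F] --> gradient A y x i 0.
Proof.
have E z : gradient A y z i 0 = \sum_r A r i * (A *m z - y) r 0.
  by rewrite mxE; under eq_bigr do rewrite [A^T _ _]mxE.
under eq_fun do rewrite E.
rewrite E; apply: cvg_sumr => r; apply: cvgM; first exact: cvg_cst.
exact: cvg_residual.
Qed.

Lemma cvg_objective A y lam :
  objective A y lam (u k) @[k --> F] --> objective A y lam x.
Proof.
apply: cvgD; apply: cvgM; try exact: cvg_cst.
  by apply: cvg_sumr => r; apply: cvg_expr2; exact: cvg_residual.
by apply: cvg_sumr => i; apply: cvg_norm.
Qed.

End Continuity.

Lemma objective_continuous A y lam : continuous (objective A y lam).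
Proof.
move=> x; apply: (@cvg_objective _ (nbhs x) (nbhs_filter x) id x).
by move=> i; exact: coord_continuous.
Qed.

End QuadraticPart.

(** * Decrease under exact line search *)

Section LineSearch.
Context {R : realType} {m n : nat}.
Implicit Types (A : 'M[R]_(m, n)) (y : 'cV[R]_m) (u v x z : 'cV[R]_n).
Implicit Types (i j : 'I_n) (lam xi a : R).

Lemma phi_ge0 A y x : 0 <= phi A y x.
Proof. by rewrite mulr_ge0 ?invr_ge0 ?ler0n //; exact: sqnorm_ge0. Qed.

Lemma norm1_ge0 x : 0 <= norm1 x.
Proof. exact: sumr_ge0. Qed.

Lemma objective_ge0 A y lam x : 0 <= lam -> 0 <= objective A y lam x.
Proof. by move=> lam0; rewrite addr_ge0 ?phi_ge0 ?mulr_ge0 ?norm1_ge0. Qed.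

Lemma norm1_add_le x v : norm1 (x + v) <= norm1 x + norm1 v.
Proof. by rewrite -big_split; apply: ler_sum => i _; rewrite mxE ler_normD. Qed.

Lemma norm1Z a x : norm1 (a *: x) = `|a| * norm1 x.
Proof. by rewrite mulr_sumr; apply: eq_bigr => i _; rewrite mxE normrM. Qed.

(** [norm1] is convex, and for the quadratic part the midpoint gap is exactly the curvature term. *)
Lemma objective_midpoint A y lam u i j xi : 0 <= lam ->
  objective A y lam (u + (xi / 2) *: pair_dir i j) <=
  (objective A y lam u + objective A y lam (u + xi *: pair_dir i j)) / 2
  - 8^-1 * curvature A i j * xi ^+ 2.
Proof.
move=> lam0; rewrite /objective !phi_line.
set d := pair_dir i j.
have : norm1 (u + (xi / 2) *: d) <= (norm1 u + norm1 (u + xi *: d)) / 2.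
  have -> : u + (xi / 2) *: d = 2^-1 *: u + 2^-1 *: (u + xi *: d).
    apply/matrixP => r c; by rewrite !mxE; lra.
  apply: (le_trans (norm1_add_le _ _)); rewrite !norm1Z ger0_norm ?invr_ge0 //.
  lra.
move/(ler_wpM2l lam0); rewrite !mulrA !mulrDr; lra.
Qed.

(** The minimum along the line is compared with the value at the midpoint of the step. *)
Lemma line_search_decrease A y lam i j u z : 0 <= lam ->
  line_search A y lam i j u z ->
  exists2 xi, z = u + xi *: pair_dir i j &
    4^-1 * curvature A i j * xi ^+ 2 <= objective A y lam u - objective A y lam z.
Proof.
move=> lam0 [xi [opt ->]]; exists xi => //.
have := objective_midpoint A y u i j xi lam0.
have := opt (xi / 2); lra.
Qed.

Lemma line_search_min A y lam i j u z : line_search A y lam i j u z ->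
  forall xi, objective A y lam z <= objective A y lam (z + xi *: pair_dir i j).
Proof. by move=> [a [opt ->]] xi; rewrite -addrA -scalerDl. Qed.

Lemma line_search_le A y lam i j u z : line_search A y lam i j u z ->
  objective A y lam z <= objective A y lam u.
Proof. by move=> [a [opt ->]]; have := opt 0; rewrite scale0r addr0. Qed.

(** If the curvature vanishes, [A] kills [pair_dir i j], so [phi] is constant on the line through 0
    and the objective is affine on the half [0 <= xi]. *)
Lemma curvature_gt0 A y lam i j : i != j ->
  strictly_convex_along A y lam i j -> 0 < curvature A i j.
Proof.
move=> ij sc; rewrite lt_def sqnorm_ge0 andbT; apply/eqP => c0.
have g0 : gradient A y 0 i 0 = gradient A y 0 j 0.
  apply/eqP; rewrite -subr_eq0 -(sum_pair_dir (fun k => gradient A y 0 k 0)); apply/eqP.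
  have -> : \sum_k gradient A y 0 k 0 * (pair_dir i j : 'cV[R]_n) k 0 =
      ((gradient A y 0)^T *m pair_dir i j) 0 0.
    by rewrite mxE; apply: eq_bigr => k _; rewrite [_^T _ _]mxE.
  rewrite trmx_mul trmxK -mulmxA; move/sqnorm_eq0: c0 => ->.
  by rewrite mulmx0 mxE.
have line xi : 0 <= xi -> objective A y lam (0 + xi *: pair_dir i j) =
    phi A y 0 + xi * (lam * norm1 (pair_dir i j : 'cV[R]_n)).
  by move=> xi0; rewrite /objective phi_line g0 c0 add0r norm1Z ger0_norm //; lra.
have f0 : feasible (0 : 'cV[R]_n) by rewrite /feasible big1 // => k _; rewrite mxE.
have := sc 0 f0 1 2 2^-1; rewrite !line; lra.
Qed.

End LineSearch.

(** As [0^-1 = 0], the sum of inverses counts only the positive values; the added 1 covers the case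
    where there is none. *)
Lemma finite_pos_lower_bound {R : realType} {I : finType} (f : I -> R) :
  (forall i, 0 <= f i) -> exists2 c, 0 < c & forall i, 0 < f i -> c <= f i.
Proof.
move=> f0; pose S := 1 + \sum_i (f i)^-1.
have S0 : 0 < S by rewrite ltr_wpDr // sumr_ge0 // => i _; rewrite invr_ge0.
exists S^-1 => [|i fi0]; first by rewrite invr_gt0.
rewrite -[leRHS]invrK lef_pV2 ?posrE ?invr_gt0 //.
rewrite /S (bigD1 i) //= addrCA lerDl addr_ge0 // sumr_ge0 // => k _.
by rewrite invr_ge0.
Qed.

Lemma sum_norm_powR_gt0 {R : realType} n (p : R) (x : 'cV[R]_n) : x != 0 ->
  0 < \sum_i `|x i 0| `^ p.
Proof.
move=> x0; rewrite lt_def sumr_ge0 => [|i _]; last exact: powR_ge0.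
rewrite andbT; apply: contra x0 => /eqP W; apply/eqP/matrixP => i c.
have /psumr_eq0P/(_ i isT)/eqP : \sum_i `|x i 0| `^ p = 0 by [].
rewrite powR_eq0 normr_eq0 => E.
by rewrite ord1 mxE; apply/eqP; have /andP[] := E (fun _ _ => powR_ge0 _ _).
Qed.

(** * Contraction of the gap by Strategy MVP when [lam = 0] *)

Section SmoothCase.
Context {R : realType} {m n : nat}.
Implicit Types (A : 'M[R]_(m, n)) (y : 'cV[R]_m) (x h u : 'cV[R]_n).
Implicit Types (i j k l : 'I_n) (p : R).

(** A linear map has a bounded right inverse on its image; here the map is [A] restricted to the
    feasible subspace. *)
Lemma feasible_bounded_lift A : exists2 C : R, 0 <= C &
  forall h, feasible h -> exists h', [/\ feasible h', A *m h' = A *m h &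
    norm1 h' <= C * norm1 (A *m h)].
Proof.
(* In row form: the rows of [K] span the transposed feasible vectors, and [M] sends a row in the
   image of [K *m A^T] to a feasible preimage under [A^T]. *)
pose e : 'cV[R]_n := const_mx 1; pose K := kermx e.
pose M := pinvmx (K *m A^T) *m K.
have feasE h : feasible h <-> h^T *m e = 0.
  rewrite /feasible; split=> [h0|/matrixP/(_ 0 0)].
    apply/matrixP => r s; rewrite !ord1 [RHS]mxE -[RHS]h0 mxE.
    by apply: eq_bigr => k _; rewrite !mxE mulr1.
  rewrite [RHS]mxE mxE => H; rewrite -[RHS]H.
  by apply: eq_bigr => k _; rewrite !mxE mulr1.
exists (\sum_r \sum_k `|M r k|) => [|h /feasE he].
  by apply: sumr_ge0 => r _; apply: sumr_ge0.
have hK : (h^T <= K)%MS by apply/sub_kermxP.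
have Ke : K *m e = 0 by exact: mulmx_ker.
have lift : (A *m h)^T *m M *m A^T = (A *m h)^T.
  by rewrite mulmxA -[LHS]mulmxA mulmxKpV // trmx_mul submxMr.
exists ((A *m h)^T *m M)^T; split.
- by apply/feasE; rewrite trmxK -mulmxA -[M *m e]mulmxA Ke !mulmx0.
- by apply: trmx_inj; rewrite trmx_mul trmxK.
set a := A *m h.
apply: (@le_trans _ _ (\sum_k \sum_r `|a r 0| * `|M r k|)).
  apply: ler_sum => k _; rewrite !mxE.
  apply: (le_trans (ler_norm_sum _ _ _)); apply: ler_sum => r _.
  by rewrite normrM [(_^T) _ _]mxE.
rewrite exchange_big /norm1 mulr_sumr; apply: ler_sum => r _.
rewrite -mulr_sumr mulrC ler_wpM2r // (bigD1 r) //= lerDl.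
by apply: sumr_ge0 => ? _; apply: sumr_ge0.
Qed.

(* A Polyak-Lojasiewicz inequality, against an arbitrary feasible [u] so that no
   minimizer has to exist. *)
Lemma phi_gap_le A y : exists2 C : R, 0 < C & forall x u i j,
  feasible x -> feasible u ->
  (forall k, gradient A y x i 0 <= gradient A y x k 0 <= gradient A y x j 0) ->
  phi A y x - phi A y u <= C * (gradient A y x j 0 - gradient A y x i 0) ^+ 2.
Proof.
have [C C0 lift] := feasible_bounded_lift A.
exists (1 + m%:R * (2^-1 * C ^+ 2)) => [|x u i j xf uf gij].
  by rewrite ltr_pwDl // mulr_ge0 // mulr_ge0 ?invr_ge0 ?sqr_ge0.
set v := _ - gradient A y x i 0.
have v0 : 0 <= v by rewrite subr_ge0; case/andP: (gij i).
(* [u] is replaced by [x + h], which has the same value of [phi] but a displacement bounded by its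
   image. *)
have [|h [hf hA hC]] := lift (u - x).
  rewrite /feasible; under eq_bigr => k _ do rewrite mxE [X in _ + X]mxE.
  by rewrite sumrB uf xf subrr.
have := phi_expand A y x h; rewrite hA => ph.
have -> : phi A y u = phi A y (x + h).
  by rewrite /phi mulmxDr hA mulmxBr [A *m x + _]addrC subrK.
rewrite ph.
(* The entries of [h] sum to 0, so the gradient may be shifted by its entry at [i]; the shifted
   entries lie between 0 and [v]. *)
have gh : - (v * norm1 h) <= \sum_k gradient A y x k 0 * h k 0.
  have -> : \sum_k gradient A y x k 0 * h k 0 =
      \sum_k (gradient A y x k 0 - gradient A y x i 0) * h k 0.
    under [RHS]eq_bigr => k _ do rewrite mulrBl.
    by rewrite sumrB -mulr_sumr hf mulr0 subr0.
  rewrite /norm1 mulr_sumr -sumrN; apply: ler_sum => k _.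
  have /andP[gi gj] := gij k.
  have hk : `|(gradient A y x k 0 - gradient A y x i 0) * h k 0| <= v * `|h k 0|.
    by rewrite normrM ler_wpM2r // ger0_norm ?subr_ge0 // lerD2r.
  by have := ler_norm (- ((gradient A y x k 0 - gradient A y x i 0) * h k 0));
    rewrite normrN; lra.
have := ler_wpM2l v0 hC.
set a := A *m (u - x) => vC.
(* Completing the square in each of the [m] coordinates. *)
have sq : - (m%:R * (2^-1 * C ^+ 2) * v ^+ 2) <=
    2^-1 * sqnorm a - v * (C * norm1 a).
  rewrite /sqnorm /norm1 !mulr_sumr -sumrB -mulrA mulr_natl -[m in leLHS]card_ord.
  rewrite -sumr_const -sumrN; apply: ler_sum => r _.
  have := sqr_ge0 (`|a r 0| - C * v); rewrite -[a r 0 ^+ 2]real_normK ?num_real //.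
  lra.
have := sqr_ge0 v; lra.
Qed.

(* An index outside the working set has gradient exactly mu(x), which is an
   average of gradients over indices inside it. *)
Lemma mvp_greedy A y p x pi i j x' : 0 < p -> x != 0 ->
  mvp_step A y 0 p x pi i j x' ->
  forall k, gradient A y x i 0 <= gradient A y x k 0 <= gradient A y x j 0.
Proof.
move=> p0 x0 [-> [iN imin] [jN jmax] _] k.
pose g l : R := gradient A y x l 0.
have up l : mvp_up A y 0 x l = g l by rewrite /mvp_up mulr0 addr0 grad_phiE.
have down l : mvp_down A y 0 x l = g l by rewrite /mvp_down mulr0 addr0 grad_phiE.
set N := nonactive _ _ _ in iN imin jN jmax.
have NP l : (l \in N) = (x l 0 != 0) || (g l != multiplier A y 0 p x).
  by rewrite !inE negb_and [mvp_pi _ _ _ _ _ _ _]mxE grad_phiE normr_le0 subr_eq0.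
pose w l := `|x l 0| `^ p.
have w0 l : 0 <= w l by exact: powR_ge0.
have W0 : 0 < \sum_l w l by exact: sum_norm_powR_gt0.
have muE : multiplier A y 0 p x * \sum_l w l = \sum_l w l * g l.
  rewrite /multiplier divfK ?gt_eqF //; apply: eq_bigr => l _.
  by rewrite mul0r addr0 grad_phiE.
have wN l : l \notin N -> w l = 0.
  by rewrite NP negb_or negbK => /andP[/eqP xh _]; rewrite /w xh normr0 powR0 ?gt_eqF.
have [kN|kN] := boolP (k \in N).
  by have := imin k kN; have := jmax k kN; rewrite !up !down => -> ->.
move: (kN); rewrite NP negb_or !negbK => /andP[_ /eqP gk].
rewrite -/(g i) -/(g j) -/(g k) gk.
rewrite -(ler_pM2r W0 (g i)) -(ler_pM2r W0 _ (g j)) muE !mulr_sumr.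
apply/andP; split; apply: ler_sum => l _; rewrite [g _ * w l]mulrC.
  have [lN|/wN ->] := boolP (l \in N); last by rewrite !mul0r.
  by rewrite ler_wpM2l //; have := imin l lN; rewrite !up.
have [lN|/wN ->] := boolP (l \in N); last by rewrite !mul0r.
by rewrite ler_wpM2l //; have := jmax l lN; rewrite !down.
Qed.

(** A trial step [v / L] along the greedy pair, with [v] the spread of the gradient and [L] a bound
    on every curvature, lowers [phi] by at least [v ^+ 2 / (2 * L)]. By [phi_gap_le] this is a fixed
    fraction of the gap. *)
Lemma smooth_mvp_contraction A y p : 0 < p -> exists2 s : R, 0 <= s < 1 &
  forall x pi i j x' u, x != 0 -> feasible x -> feasible u ->
    mvp_step A y 0 p x pi i j x' ->
    phi A y x' - phi A y u <= s * (phi A y x - phi A y u).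
Proof.
move=> p0; have [C C0 gap] := phi_gap_le A y.
(* The term [C^-1] ensures [L > 0] and [C * L >= 1], which puts the contraction factor in the
   required interval. *)
pose L : R := C^-1 + \sum_(ij : 'I_n * 'I_n) curvature A ij.1 ij.2.
have LC i j : curvature A i j <= L.
  rewrite /L (bigD1 (i, j)) //= addrCA lerDl addr_ge0 ?invr_ge0 ?(ltW C0) //.
  by apply: sumr_ge0 => ? _; exact: sqnorm_ge0.
have L0 : 0 < L.
  rewrite /L ltr_pwDl ?invr_gt0 //.
  by apply: sumr_ge0 => ? _; exact: sqnorm_ge0.
have CL : 1 <= C * L.
  rewrite -[leLHS](@mulfV _ C) ?gt_eqF // ler_pM2l // lerDl.
  by apply: sumr_ge0 => ? _; exact: sqnorm_ge0.
exists (1 - (2 * (C * L))^-1) => [|x pi i j x' u x0 xf uf st].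
  have q1 : (2 * (C * L))^-1 <= 1 by rewrite invf_le1; lra.
  by rewrite subr_ge0 q1 gtrDl oppr_lt0 invr_gt0; lra.
have g := mvp_greedy p0 x0 st.
have := gap x u i j xf uf g.
case: st => _ _ _ [xi [opt ->]].
set v := gradient A y x j 0 - gradient A y x i 0.
have := opt (v / L); rewrite /objective !mul0r !addr0.
rewrite [leRHS]phi_line => descent gapC.
set q := v / L in descent.
have vE : v = q * L by rewrite /q divfK // gt_eqF.
have ng : gradient A y x i 0 - gradient A y x j 0 = - (q * L) by rewrite -vE opprB.
have curv : 2^-1 * q ^+ 2 * curvature A i j <= 2^-1 * q ^+ 2 * L.
  by rewrite ler_wpM2l // mulr_ge0 ?invr_ge0 ?sqr_ge0.
have : (2 * (C * L))^-1 * (phi A y x - phi A y u) <= 2^-1 * q ^+ 2 * L.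
  have -> : 2^-1 * q ^+ 2 * L = (2 * (C * L))^-1 * (C * v ^+ 2).
    by rewrite vE; field; rewrite !gt_eqF.
  by rewrite ler_wpM2l // invr_ge0; lra.
rewrite ng in descent; lra.
Qed.

End SmoothCase.

(** * Displacements bounded by the decrease of the objective *)

Section Displacement.
Context {R : realType} {m n : nat}.
Implicit Types (A : 'M[R]_(m, n)) (y : 'cV[R]_m) (x u v z : 'cV[R]_n).
Implicit Types (i j : 'I_n) (s : seq 'I_n) (lam c eta xi : R).

Lemma norm1_pair_dir_le i j : norm1 (pair_dir i j : 'cV[R]_n) <= 2.
Proof.
have -> : (2 : R) = \sum_k (1 * (k == i)%:R + 1 * (k == j)%:R).
  by rewrite big_split /= !sum_unit.
apply: ler_sum => k _; rewrite pair_dirE !mul1r.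
by apply: (le_trans (ler_normB _ _)); rewrite !normr_nat.
Qed.

(** The curvature bound is asked only for [i != j]: the pivot occurs in its own sweep, where the
    direction is 0 and nothing moves. *)
Lemma line_search_displacement A y lam c eta i j u z : 0 <= lam -> 0 < c ->
  (i != j -> c <= curvature A i j) -> 0 <= eta ->
  objective A y lam u - objective A y lam z <= 4^-1 * c * eta ^+ 2 ->
  line_search A y lam i j u z -> norm1 (z - u) <= 2 * eta.
Proof.
move=> lam0 c0 hc eta0 dec /(line_search_decrease lam0) [xi zE dec'].
rewrite zE addrAC subrr add0r norm1Z.
have [ij|/hc cij] := eqVneq i j.
  rewrite ij pair_dir_id /norm1 big1 ?mulr0 ?mulr_ge0 // => k _.
  by rewrite mxE normr0.
rewrite mulrC ler_pM ?norm1_ge0 ?norm1_pair_dir_le //.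
rewrite -(@ler_pXn2r _ 2) ?nnegrE // real_normK ?num_real //.
rewrite -(@ler_pM2l _ (4^-1 * c)) ?mulr_gt0 ?invr_gt0 //.
have : 4^-1 * c * xi ^+ 2 <= 4^-1 * curvature A i j * xi ^+ 2.
  by rewrite ler_wpM2r ?sqr_ge0 // ler_wpM2l.
lra.
Qed.

Lemma sweep_le A y lam j s u u' :
  sweep A y lam j s u u' -> objective A y lam u' <= objective A y lam u.
Proof.
elim: s u => [u ->|i s IH u [z [ls sw]]] //.
exact: le_trans (IH _ sw) (line_search_le ls).
Qed.

Lemma line_search_feasible A y lam i j u z :
  line_search A y lam i j u z -> feasible u -> feasible z.
Proof. by move=> [xi [_ ->]]; exact: feasible_line. Qed.

Lemma sweep_feasible A y lam j s u u' :
  sweep A y lam j s u u' -> feasible u -> feasible u'.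
Proof.
elim: s u => [u ->|i s IH u [z [ls sw]] uf] //.
exact: IH sw (line_search_feasible ls uf).
Qed.

(** No single search decreases more than the whole sweep, so each moves by at most [2 * eta]. The
    point [z] given for [i] is the one just after a search along [pair_dir i j]. *)
Lemma sweep_displacement A y lam c eta j s u u' : 0 <= lam -> 0 < c ->
  (forall i, i \in s -> i != j -> c <= curvature A i j) -> 0 <= eta ->
  objective A y lam u - objective A y lam u' <= 4^-1 * c * eta ^+ 2 ->
  sweep A y lam j s u u' ->
  norm1 (u' - u) <= (size s)%:R * (2 * eta) /\
  forall i, i \in s -> exists2 z, norm1 (z - u) <= (size s)%:R * (2 * eta) &
    forall xi, objective A y lam z <= objective A y lam (z + xi *: pair_dir i j).
Proof.
move=> lam0 c0 + eta0; elim: s u => [|i s IH] u hc dec.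
  by move=> ->; rewrite subrr mul0r /norm1 big1 // => k _; rewrite mxE normr0.
move=> [z [ls sw]].
have zu : norm1 (z - u) <= 2 * eta.
  apply: line_search_displacement c0 _ eta0 _ ls => //.
    by apply: hc; rewrite mem_head.
  by have := sweep_le sw; lra.
have tri v : norm1 (v - z) <= (size s)%:R * (2 * eta) ->
    norm1 (v - u) <= (size (i :: s))%:R * (2 * eta).
  move=> vz; have -> : v - u = v - z + (z - u) by rewrite addrA subrK.
  apply: (le_trans (norm1_add_le _ _)).
  by rewrite [size _]/= mulrSr mulrDl mul1r lerD.
have [||uz IHz] := IH z _ _ sw.
- by move=> k ks; apply: hc; rewrite inE ks orbT.
- by have := line_search_le ls; lra.
split=> [|k]; first exact: tri.
rewrite inE => /orP[/eqP ->|/IHz[w wz wmin]]; last by exists w => //; exact: tri.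
exists z; last exact: line_search_min ls.
rewrite [size _]/= mulrSr mulrDl mul1r; apply: (le_trans zu).
by rewrite lerDr !mulr_ge0.
Qed.

End Displacement.

(** The increments of [a] are summable: [w] shrinks by the factor [s] at every other step and does
    not grow in between. *)
Lemma alternating_contraction_bounded {R : realType} (a w : nat -> R)
    (b : nat -> bool) (C s : R) (K : nat) : 0 <= C -> 0 <= s < 1 ->
  (forall k, 0 <= w k) ->
  (forall k, (K <= k)%N -> a k.+1 <= a k + C * w k) ->
  (forall k, (K <= k)%N -> w k.+1 <= w k) ->
  (forall k, (K <= k)%N -> b k -> w k.+1 <= s * w k) ->
  (forall k, (K <= k)%N -> b k.+1 = ~~ b k) ->
  exists B, forall k, (K <= k)%N -> a k <= B.
Proof.
move=> C0 /andP[s0 s1] w0 aw wmon wb alt.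
(* [M] solves [C + (M + C) * s = M], which keeps the potential [V] below from growing at a
   contraction. *)
pose M := (C + C * s) / (1 - s).
have M0 : 0 <= M by apply: divr_ge0; [rewrite addr_ge0 ?mulr_ge0|rewrite subr_ge0 ltW].
have ME : C + (M + C) * s = M.
  have : M * (1 - s) = C + C * s by rewrite divfK // gt_eqF // subr_gt0.
  lra.
(* [V] is nonincreasing; the last term pays for the step before a contraction. *)
pose V k := a k + M * w k + (if b k then 0 else C * w k).
exists (V K) => k Kk; apply: (@le_trans _ _ (V k)).
  rewrite /V -addrA lerDl; apply: addr_ge0; first exact: mulr_ge0.
  by case: (b k) => //; apply: mulr_ge0.
rewrite -(subnKC Kk); elim: (k - K)%N => [|l IH]; first by rewrite addn0.
apply: (le_trans _ IH); rewrite addnS; set l' := (K + l)%N.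
have Kl : (K <= l')%N by rewrite leq_addr.
rewrite /V alt //; have := aw _ Kl; have [bl|bl] /= := boolP (b l').
  have := ler_wpM2l (addr_ge0 M0 C0) (wb _ Kl bl).
  rewrite -[in X in _ -> _ -> _ <= X]ME; lra.
have := ler_wpM2l M0 (wmon _ Kl); lra.
Qed.

(** * Monotonicity, alternation and boundedness of the run *)

Section Run.
Context {R : realType} {m n : nat} (A : 'M[R]_(m, n)) (y : 'cV[R]_m).
Context (lam p theta tau : R) (T : trace R n).
Context (hlam : 0 <= lam) (hp : 0 < p) (htheta : 0 < theta <= 1).
Context (htau : 0 < tau <= 1) (hrun : AS_ZSL_run A y lam p theta tau T).
Context (hconv : forall i j : 'I_n, i != j -> selected_pair T i j ->
  strictly_convex_along A y lam i j).

Notation f := (objective A y lam).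
Notation x := (pt T).

Lemma run_feasible k : feasible (x k).
Proof.
case: k => [|k].
  by rewrite (run_pt0 hrun) /feasible big1 // => i _; rewrite mxE.
elim: k => [|k IH]; first exact: run_pt1 hrun.
have [mvp|ac] := boolP (uses_mvp T k.+1).
  by have [_ _ _ /line_search_feasible] := run_mvp hrun (ltn0Sn k) mvp; apply.
by have [_ _ _ /sweep_feasible] := run_ac2cd hrun (ltn0Sn k) ac; apply.
Qed.

Lemma run_objective_le k : f (x k.+1) <= f (x k).
Proof.
case: k => [|k]; first exact/ltW/(run_pt1_lt hrun).
have [mvp|ac] := boolP (uses_mvp T k.+1).
  by have [_ _ _ /line_search_le] := run_mvp hrun (ltn0Sn k) mvp.
by have [_ _ _ /sweep_le] := run_ac2cd hrun (ltn0Sn k) ac.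
Qed.

Lemma run_objective_noninc k l : (k <= l)%N -> f (x l) <= f (x k).
Proof.
move/subnKC <-; elim: (l - k)%N => [|d IH]; first by rewrite addn0.
by rewrite addnS; apply: le_trans (run_objective_le _) IH.
Qed.

(** From iteration 1 on the objective is below its value at 0. This makes [multiplier] meaningful at
    the iterates. *)
Lemma run_neq0 k : (0 < k)%N -> x k != 0.
Proof.
move=> k0; apply/eqP => xk.
have := run_objective_noninc k0; have := run_pt1_lt hrun.
by rewrite xk (run_pt0 hrun) => /lt_le_trans /[apply]; rewrite ltxx.
Qed.

Lemma run_objective_cvg : f (x k) @[k --> \oo] --> limn (f \o x).
Proof.
apply: nonincreasing_is_cvgn.
  by apply/nonincreasing_seqP => k; exact: run_objective_le.
by exists 0 => _ [k _ <-]; exact: objective_ge0.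
Qed.

Lemma run_objective_lim_le k : limn (f \o x) <= f (x k).
Proof.
apply: (@nonincreasing_cvgn_ge _ (f \o x)).
  by apply/nonincreasing_seqP => l; exact: run_objective_le.
exact/cvgP/run_objective_cvg.
Qed.

(** Once the objective is within [theta] of its limit the relative decrease passes the test, its
    denominator being at least 1. Only the ban on two successive MVP steps then decides. *)
Lemma run_alternates : exists2 K, (0 < K)%N &
  forall k, (K <= k)%N -> uses_mvp T k.+1 = ~~ uses_mvp T k.
Proof.
have [theta0 _] := andP htheta.
have /cvgrPdist_lt/(_ _ theta0) [K _ HK] := run_objective_cvg.
exists K.+1 => // -[//|k] Kk; rewrite (run_choice hrun).
suff -> : (f (x k.+1) - f (x k.+2)) / Num.max (f (x k.+1)) 1 <= theta by [].
have max1 : 1 <= Num.max (f (x k.+1)) 1 by rewrite le_max lexx orbT.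
rewrite ler_pdivrMr ?(lt_le_trans ltr01) //.
have := HK k.+1 (ltnW Kk); rewrite /= distrC ger0_norm; last first.
  by rewrite subr_ge0 run_objective_lim_le.
move=> close; have := run_objective_lim_le k.+2.
have := ler_wpM2l (ltW theta0) max1; lra.
Qed.

Lemma run_displacement : exists2 D : R, 0 <= D & forall k, (0 < k)%N ->
  norm1 (x k.+1 - x k) <= D * Num.sqrt (f (x k) - f (x k.+1)) /\
  (~~ uses_mvp T k ->
    forall i, i \in nonactive lam (x k) (mult_est T k) ->
    exists2 z, norm1 (z - x k) <= D * Num.sqrt (f (x k) - f (x k.+1)) &
      forall xi, f z <= f (z + xi *: pair_dir i (pivot T k))).
Proof.
(* One lower bound for all positive curvatures; strict convexity puts the selected pairs among
   them. *)
have [c c0 hc] := @finite_pos_lower_bound R ('I_n * 'I_n)%type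
  (fun ij => curvature A ij.1 ij.2) (fun ij => sqnorm_ge0 _).
have csel i j : selected_pair T i j -> i != j -> c <= curvature A i j.
  move=> sel ij; apply: (hc (i, j)).
  exact: curvature_gt0 ij (hconv ij sel).
have c4 : 0 <= 4 * c^-1 by rewrite mulr_ge0 // invr_ge0 ltW.
(* An iteration makes at most [n] searches, each moving by at most [2 * eta], where
   [4^-1 * c * eta ^+ 2 = dec]. *)
exists (n%:R * (2 * Num.sqrt (4 * c^-1))) => [|k k0].
  by rewrite !mulr_ge0 ?sqrtr_ge0.
set dec := f (x k) - f (x k.+1).
have dec0 : 0 <= dec by rewrite subr_ge0 run_objective_le.
pose eta := Num.sqrt (4 * c^-1 * dec).
have -> : n%:R * (2 * Num.sqrt (4 * c^-1)) * Num.sqrt dec = n%:R * (2 * eta).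
  by rewrite /eta (sqrtrM dec c4); ring.
have eta0 : 0 <= eta by exact: sqrtr_ge0.
have decE : dec <= 4^-1 * c * eta ^+ 2.
  rewrite sqr_sqrtr; last exact: mulr_ge0.
  suff -> : 4^-1 * c * (4 * c^-1 * dec) = dec by [].
  by field; rewrite gt_eqF.
have [mvp|ac] := boolP (uses_mvp T k); split=> //.
  have [_ _ _ ls] := run_mvp hrun k0 mvp.
  have sel : selected_pair T (ihat T k) (jhat T k) by exists k => //; rewrite mvp.
  apply: le_trans (line_search_displacement hlam c0 (csel _ _ sel) eta0 decE ls) _.
  rewrite ler_peMl ?mulr_ge0 // ler1n.
  exact: leq_ltn_trans (ltn_ord (ihat T k)).
all: have [_ _ perm sw] := run_ac2cd hrun k0 ac.
all: have sel i : i \in pivot_order T k -> i != pivot T k -> c <= curvature A i (pivot T k)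
  by move=> ik; apply: csel; exists k => //; rewrite (negPf ac).
all: have size_le : (size (pivot_order T k))%:R * (2 * eta) <= n%:R * (2 * eta)
  by rewrite ler_wpM2r ?mulr_ge0 // ler_nat (perm_size perm) -cardE -[leqRHS]card_ord max_card.
all: have [disp zs] := sweep_displacement hlam c0 sel eta0 decE sw.
  exact: le_trans disp size_le.
move=> _ i iN; have [|z zx zmin] := zs i.
  by rewrite (perm_mem perm) mem_enum.
by exists z => //; exact: le_trans zx size_le.
Qed.

Lemma run_bounded : exists B, \forall k \near \oo, norm1 (x k) <= B.
Proof.
have [K K0 alt] := run_alternates.
have [lam0|lam0] := eqVneq lam 0; last first.
  exists (f 0 / lam); near=> k.
  rewrite ler_pdivlMr ?lt_def ?lam0 //.
  have := run_objective_noninc (leq0n k); rewrite (run_pt0 hrun) {1}/objective.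
  have := phi_ge0 A y (x k); lra.
have [D D0 disp] := run_displacement.
have [s /andP[s0 s1] contr] := smooth_mvp_contraction A y hp.
pose E k := f (x k) - limn (f \o x).
have E0 k : 0 <= E k by rewrite subr_ge0 run_objective_lim_le.
have [||||||B HB] := @alternating_contraction_bounded R (fun k => norm1 (x k))
  (fun k => Num.sqrt (E k)) (uses_mvp T) D (Num.sqrt s) K D0.
- rewrite sqrtr_ge0 -[ltRHS]sqrtr1 ltr_sqrt //.
- by move=> k; exact: sqrtr_ge0.
- move=> k Kk; rewrite -{1}[x k.+1](subrKC (x k)).
  apply: le_trans (norm1_add_le _ _) _; rewrite lerD2l.
  have [le_disp _] := disp k (leq_trans K0 Kk); apply: le_trans le_disp _.
  rewrite ler_wpM2l // ler_wsqrtr // lerD2l lerN2.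
  exact: run_objective_lim_le.
- by move=> k _; rewrite ler_wsqrtr // lerD2r run_objective_le.
- move=> k Kk mvp; rewrite -sqrtrM // ler_wsqrtr //.
  have k0 := leq_trans K0 Kk.
  have step := run_mvp hrun k0 mvp; rewrite lam0 in step.
  have phiE u : f u = phi A y u by rewrite /objective lam0 mul0r addr0.
  (* The limit value is not known to be attained, so the contraction is taken against [x l], and
     then [l] tends to infinity. *)
  have gap l : phi A y (x k.+1) - f (x l) <= s * (phi A y (x k) - f (x l)).
    rewrite phiE; apply: contr step; try exact: run_feasible.
    exact: run_neq0.
  have : (phi A y (x k.+1) - s * phi A y (x k)) / (1 - s) <= limn (f \o x).
    apply: limr_ge; first exact/cvgP/run_objective_cvg.
    near=> l; rewrite ler_pdivrMr ?subr_gt0 //; have := gap l; rewrite /=; lra.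
  rewrite ler_pdivrMr ?subr_gt0 // /E !phiE; lra.
- exact: alt.
- by exists B; exists K.
Unshelve. all: by end_near.
Qed.

End Run.

(** * First-order optimality conditions *)

Lemma linear_coef_le {R : realFieldType} (a b l e : R) : 0 <= b -> 0 < e ->
  (forall t, `|t| < e -> 0 <= t * a + b * t ^+ 2 + l * `|t|) -> `|a| <= l.
Proof.
move=> b0 e0 H; rewrite leNgt; apply/negP => la.
(* For small [t] the linear term beats the quadratic one: test at -sg(a) t. *)
pose q := (`|a| - l) / (b + 1).
have b1 : 0 < b + 1 by lra.
have q0 : 0 < q by rewrite divr_gt0 // subr_gt0.
have qE : q * b = `|a| - l - q.
  by have : q * (b + 1) = `|a| - l; [rewrite divfK // gt_eqF|lra].
pose t := Num.min (e / 2) q.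
have t0 : 0 < t by rewrite lt_min q0 andbT divr_gt0.
have te : t < e by rewrite gt_min; apply/orP; left; lra.
have tq : t <= q by rewrite ge_min lexx orbT.
have abst : `|t| = t by rewrite gtr0_norm.
have sgt c : `|a| = c * a -> `|- (c * t)| = t ->
    0 <= - (t * `|a|) + b * t ^+ 2 + l * t.
  move=> ca ct; have := H (- (c * t)); rewrite ct => /(_ te).
  have -> : (- (c * t)) ^+ 2 = t ^+ 2 by rewrite -real_normK ?num_real // ct.
  by have -> : - (c * t) * a = - (t * `|a|) by rewrite ca; ring.
have : 0 <= - (t * `|a|) + b * t ^+ 2 + l * t.
  have [a0|a0] := leP 0 a.
    by apply: (sgt 1); rewrite mul1r ?normrN // ger0_norm.
  by apply: (sgt (-1)); rewrite mulN1r ?opprK // ltr0_norm.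
have -> : - (t * `|a|) + b * t ^+ 2 + l * t = t * (b * t - (`|a| - l)) by ring.
rewrite pmulr_rge0 // => bt.
have := ler_wpM2l b0 tq; lra.
Qed.

Lemma norm_shift {R : realDomainType} (a t : R) :
  `|t| < `|a| -> `|a + t| = `|a| + Num.sg a * t.
Proof.
have [a0|a0|->] := ltgtP a 0; rewrite ?normr0 ?normr_lt0 //.
  rewrite (ltr0_norm a0) ltr0_sg // ltr_norml opprK => /andP[_ ta].
  by rewrite ltr0_norm; [ring|lra].
rewrite (gtr0_norm a0) gtr0_sg // ltr_norml => /andP[ta _].
by rewrite gtr0_norm; [ring|lra].
Qed.

Section Optimality.
Context {R : realType} {m n : nat} (A : 'M[R]_(m, n)) (y : 'cV[R]_m) (lam : R).
Context (hlam : 0 <= lam).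
Implicit Types (x u : 'cV[R]_n) (i j : 'I_n).

(** Says that [nu] is the partial derivative of [phi] plus [lam] times a subgradient of the absolute
    value at [x i 0]; [nu] is the multiplier of the constraint. *)
Definition stationary_at x (nu : R) i : bool :=
  if x i 0 == 0 then `|gradient A y x i 0 - nu| <= lam
  else gradient A y x i 0 + lam * Num.sg (x i 0) == nu.

(** The subgradient inequalities are summed over the coordinates; the term in [nu] cancels since
    both points have coordinate sum 0, and the quadratic remainder is nonnegative. *)
Lemma kkt_optimal x nu : feasible x ->
  (forall i, stationary_at x nu i) ->
  optimal A y lam x.
Proof.
move=> fx kkt; split=> // u fu.
have : nu * \sum_i (u i 0 - x i 0) <=
    \sum_i (gradient A y x i 0 * (u i 0 - x i 0) +
            lam * (`|u i 0| - `|x i 0|)).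
  rewrite mulr_sumr; apply: ler_sum => i _.
  have := kkt i; rewrite /stationary_at; have [xi0|xi0] := eqVneq (x i 0) 0.
    rewrite xi0 normr0 !subr0 ler_norml => /andP[g1 g2].
    have [u0|u0] := leP 0 (u i 0).
      rewrite (ger0_norm u0); have := ler_wpM2r u0 g1; lra.
    have u0' : 0 <= - u i 0 by lra.
    rewrite (ltr0_norm u0); have := ler_wpM2r u0' g2; lra.
  move=> /eqP <-.
  have : lam * (Num.sg (x i 0) * u i 0) <= lam * `|u i 0|.
    apply: ler_wpM2l => //; apply: (le_trans (ler_norm _)).
    by rewrite normrM normr_sg xi0 mul1r.
  rewrite [X in _ -> _ <= _ + _ * (_ - X)]normrEsg; lra.
rewrite sumrB fu fx subrr mulr0 big_split /= -mulr_sumr sumrB.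
rewrite -/(norm1 u) -/(norm1 x) /objective.
have -> : u = x + (u - x) by rewrite addrC subrK.
rewrite phi_expand [x + (u - x)]addrC subrK.
have -> : \sum_i gradient A y x i 0 * (u - x) i 0 =
    \sum_i gradient A y x i 0 * (u i 0 - x i 0).
  by apply: eq_bigr => i _; rewrite !mxE.
have := sqnorm_ge0 (A *m (u - x)); lra.
Qed.

Lemma norm1_line x i j t : i != j ->
  norm1 (x + t *: pair_dir i j) =
  norm1 x + (`|x i 0 + t| - `|x i 0|) + (`|x j 0 - t| - `|x j 0|).
Proof.
move=> ij; have E k : (x + t *: pair_dir i j) k 0 =
    x k 0 + t * ((k == i)%:R - (k == j)%:R) by rewrite mxE [X in _ + X]mxE pair_dirE.
rewrite /norm1 (bigD1 i) // (bigD1 j) /=; last by rewrite eq_sym.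
rewrite [in RHS](bigD1 i) // [in RHS](bigD1 j) /=; last by rewrite eq_sym.
under eq_bigr => k /andP[/negPf ki /negPf kj] do
  rewrite E ki kj subrr mulr0 addr0.
rewrite !E !eqxx (negPf ij) eq_sym (negPf ij) subr0 sub0r mulr1 mulrN1.
ring.
Qed.

(** The absolute value is differentiable at [x j 0], so coordinate [j] fixes the multiplier and
    minimality along the line becomes a condition on coordinate [i] alone. *)
Lemma pair_stationary x i j : i != j -> x j 0 != 0 ->
  (forall t, objective A y lam x <= objective A y lam (x + t *: pair_dir i j)) ->
  stationary_at x (gradient A y x j 0 + lam * Num.sg (x j 0)) i.
Proof.
move=> ij xj opt; rewrite /stationary_at.
set nu := _ + _ * Num.sg (x j 0).
have c0 : 0 <= 2^-1 * curvature A i j by rewrite mulr_ge0 ?invr_ge0 ?sqnorm_ge0.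
have xj0 : 0 < `|x j 0| by rewrite normr_gt0.
have var t : `|t| < `|x j 0| ->
    0 <= t * (gradient A y x i 0 - nu) + 2^-1 * curvature A i j * t ^+ 2
      + lam * (`|x i 0 + t| - `|x i 0|).
  move=> tj; have := opt t; rewrite /objective phi_line norm1_line //.
  rewrite [X in X - `|x j 0|]norm_shift ?normrN // /nu; lra.
have [xi0|xi0] := eqVneq (x i 0) 0.
  apply: (linear_coef_le c0 xj0) => t /var.
  by rewrite xi0 add0r normr0 subr0.
(* The absolute value is also affine near [x i 0], so [linear_coef_le] with bound 0 yields the
   equality. *)
rewrite -subr_eq0 -normr_le0.
apply: (@linear_coef_le _ _ _ _ (Num.min `|x i 0| `|x j 0|) c0).
  by rewrite lt_min xj0 normr_gt0 xi0.
move=> t; rewrite lt_min => /andP[ti /var]; rewrite (norm_shift ti); lra.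
Qed.

End Optimality.

(** * Continuity of the multiplier function away from 0 *)

Section MultiplierContinuity.
Context {R : realType} {U : Type} {F : set_system U} {FF : Filter F}.
Implicit Type p : R.

Lemma cvg_norm_powR p (a : U -> R) (l : R) : 0 < p ->
  a k @[k --> F] --> l -> `|a k| `^ p @[k --> F] --> `|l| `^ p.
Proof.
move=> p0 al; have nal : `|a k| @[k --> F] --> `|l| by exact: cvg_norm.
have [l0|l0] := eqVneq l 0; last first.
  have cont : {for `|l|, continuous (@powR R ^~ p)}.
    apply: differentiable_continuous; apply/derivable1_diffP.
    by apply: derivable_powR; rewrite in_itv /= andbT normr_gt0.
  exact: (cvg_comp (fun k => `|a k|) _ nal cont).
rewrite l0 normr0 powR0 ?gt_eqF //.
apply/cvgr0Pnorm_lt => e e0.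
have /cvgr0Pnorm_lt/(_ _ e0) [d /= d0 Hd] := powR_cvg0 p0.
rewrite l0 normr0 in nal; have near_d := cvgr0_norm_lt _ nal _ d0.
near=> k.
have ad : `|a k| < d.
  rewrite -normr_id; near: k; exact: near_d.
(* [powR_cvg0] is a limit from the right, which leaves out the terms equal to 0. *)
have [->|ak] := eqVneq (a k) 0; first by rewrite normr0 powR0 ?gt_eqF // normr0.
by apply: Hd; rewrite ?normr_gt0 //= sub0r normrN normr_id.
Unshelve. all: by end_near. Qed.

(** The sign jumps at 0, but there the weight tends to 0; elsewhere the sign is eventually
    constant. *)
Lemma cvg_norm_powR_sg p (a : U -> R) (l : R) : 0 < p ->
  a k @[k --> F] --> l ->
  `|a k| `^ p * Num.sg (a k) @[k --> F] --> `|l| `^ p * Num.sg l.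
Proof.
move=> p0 al; have pal := cvg_norm_powR p0 al.
have [l0|l0] := eqVneq l 0.
  rewrite l0 sgr0 mulr0; apply: norm_cvg0.
  rewrite l0 normr0 powR0 ?gt_eqF // in pal.
  apply: (squeeze_cvgr _ (cvg_cst 0) pal); apply: nearW => k.
  rewrite normr_ge0 normrM normr_sg ger0_norm ?powR_ge0 //.
  by case: (a k != 0); rewrite ?mulr1 ?mulr0 ?lexx ?powR_ge0.
apply: cvgM => //; apply: cvg_near_cst.
have l1 : 0 < `|l| by rewrite normr_gt0.
have near_l := cvgr_dist_lt _ _ al _ l1.
near=> k.
have : `|l - a k| < `|l| by near: k; exact: near_l.
have [ln|lp|le0] := ltgtP l 0; last by rewrite le0 eqxx in l0.
  by rewrite (ltr0_norm ln) ltr_norml => /andP[? _]; rewrite !ltr0_sg //; lra.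
by rewrite (gtr0_norm lp) ltr_norml => /andP[_ ?]; rewrite !gtr0_sg //; lra.
Unshelve. all: by end_near. Qed.

Lemma cvg_multiplier m n (A : 'M[R]_(m, n)) y lam p
    (u : U -> 'cV[R]_n) (x : 'cV[R]_n) : 0 < p -> x != 0 ->
  (forall i, u k i 0 @[k --> F] --> x i 0) ->
  multiplier A y lam p (u k) @[k --> F] --> multiplier A y lam p x.
Proof.
move=> p0 x0 cvu.
apply: cvgM; last first.
  apply: cvgV; first by rewrite gt_eqF // sum_norm_powR_gt0.
  by apply: cvg_sumr => i; exact: cvg_norm_powR.
apply: cvg_sumr => i; rewrite mulrDr mulrCA.
under eq_fun do rewrite mulrDr mulrCA grad_phiE.
rewrite grad_phiE; apply: cvgD.
  by apply: cvgM; [exact: cvg_norm_powR|exact: cvg_gradient].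
by apply: cvgM; [exact: cvg_cst|exact: cvg_norm_powR_sg].
Qed.

End MultiplierContinuity.

(** * Ultrafilters and cluster points *)

Lemma ultra_cvg_bounded {R : realType} {U : Type} (F : set_system U)
    (a : U -> R) (B : R) : UltraFilter F ->
  (\forall k \near F, `|a k| <= B) -> exists l : R, a k @[k --> F] --> l.
Proof.
move=> FU aB; have FF := @ultra_proper _ _ FU.
have [|l [_ cl]] := @segment_compact R (- B) B (a k @[k --> F]) _.
  by apply: (@filterS _ F _ _ _ _ aB) => k; rewrite /= in_itv /= ler_norml.
exists l => V lV; have [//|FnV] := in_ultra_setVsetC (a @^-1` V) FU.
by have [z []] := cl (~` V) V FnV lV.
Qed.

(** Takes the place of a subsequence on which [g] is constant. *)
Lemma ultra_finite_fiber {U : Type} {I : finType} (F : set_system U)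
    (g : U -> I) : UltraFilter F -> exists i, \forall k \near F, g k = i.
Proof.
move=> FU; have FF := @ultra_proper _ _ FU.
apply: contrapT => no.
have : \forall k \near F, forall i, g k <> i.
  apply: filter_forall => i.
  by have [Fi|//] := in_ultra_setVsetC [set k | g k = i] FU; case: no; exists i.
by move=> /filter_ex [k /(_ (g k))].
Qed.

Lemma cvg_mx_coord {R : realType} {U : Type} {n : nat} (F : set_system U)
    (u : U -> 'cV[R]_n) (x : 'cV[R]_n) : Filter F ->
  (forall i, u k i 0 @[k --> F] --> x i 0) -> u k @[k --> F] --> x.
Proof.
move=> FF cvu V [Q HQ sub].
have : \forall k \near F, forall i, Q i 0 (u k i 0).
  by apply: filter_forall => i; apply: cvu; exact: HQ.
by apply: filterS => k Qk; apply: sub => i j; rewrite ord1.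
Qed.

Lemma cluster_cvg_value {R : realType} {S : topologicalType}
    (F : set_system S) (g : S -> R) (z : S) (l : R) : Filter F ->
  {for z, continuous g} -> g s @[s --> F] --> l -> cluster F z -> g z = l.
Proof.
move=> FF gz gl Fz; apply: norm_hausdorff => V W Vgz Wl.
have [s [gs1 gs2]] := Fz (g @^-1` W) (g @^-1` V) (gl _ Wl) (gz _ Vgz).
by exists (g s).
Qed.

Lemma norm_coord_le {R : realType} {n : nat} (x : 'cV[R]_n) i : `|x i 0| <= `|x|.
Proof.
rewrite [leRHS]mx_normrE.
exact: (le_bigmax _ (fun ij : 'I_n * 'I_1 => `|x ij.1 ij.2|) (i, 0)).
Qed.

Lemma norm1_coord_le {R : realType} {n : nat} (x : 'cV[R]_n) i : `|x i 0| <= norm1 x.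
Proof. by rewrite /norm1 (bigD1 i) //= lerDl sumr_ge0. Qed.

(** * Optimality of a limit along the MVP iterations *)

Section Limit.
Context {R : realType} {m n : nat} (A : 'M[R]_(m, n)) (y : 'cV[R]_m).
Context (lam p theta tau : R) (T : trace R n).
Context (hlam : 0 <= lam) (hp : 0 < p) (htheta : 0 < theta <= 1).
Context (htau : 0 < tau <= 1) (hrun : AS_ZSL_run A y lam p theta tau T).
Context (hconv : forall i j : 'I_n, i != j -> selected_pair T i j ->
  strictly_convex_along A y lam i j).

Notation f := (objective A y lam).
Notation x := (pt T).

(** By alternation one of [k] and [k.+1] is an MVP iteration, so these meet every tail and the
    restricted filter is proper. *)
Lemma mvp_ultrafilter : exists F : set_system nat,
  [/\ UltraFilter F, \oo `<=` F & \forall k \near F, uses_mvp T k].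
Proof.
have [K K0 alt] := run_alternates hlam htheta hrun.
have prop : ProperFilter (within (fun k => uses_mvp T k) \oo).
  apply: Build_ProperFilter => -[N _ HN].
  pose k := maxn K N.
  have NK : (N <= k)%N by rewrite leq_maxr.
  have [mvp|ac] := boolP (uses_mvp T k); first exact: (HN k).
  apply: (HN k.+1) => /=; first exact: leqW.
  by rewrite alt ?leq_maxl.
have [F [FU sub]] := ultraFilterLemma prop.
exists F; split=> //.
  by move=> V [N _ HN]; apply: sub; exists N => // k /HN.
by apply: sub; exists 0%N.
Qed.

Lemma mvp_limit_optimal : exists F (xs : 'cV[R]_n),
  [/\ ProperFilter F, \oo `<=` F, x k @[k --> F] --> xs & optimal A y lam xs].
Proof.
have [F [FU ooF Fmvp]] := mvp_ultrafilter.
have FF := @ultra_proper _ _ FU.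
have FK K : \forall k \near F, (K <= k)%N by apply: ooF; exists K.
have [B /ooF xB] := run_bounded hlam hp htheta hrun hconv.
have [l cvl] : {l : 'I_n -> R & forall i, x k i 0 @[k --> F] --> l i}.
  apply: (@choice _ _ (fun i (c : R) => x k i 0 @[k --> F] --> c)) => i.
  apply: (@ultra_cvg_bounded _ _ _ _ B).
  by apply: filterS xB => k; apply: le_trans; exact: norm1_coord_le.
pose xs : 'cV[R]_n := \col_i l i.
have cvx i : x k i 0 @[k --> F] --> xs i 0 by rewrite mxE; exact: cvl.
have fxs : f xs = limn (f \o x).
  apply: (@cvg_unique _ (@norm_hausdorff _ _) (f (x k) @[k --> F])).
    exact: cvg_objective.
  apply: cvg_trans (run_objective_cvg hlam hrun) => V /=; exact: ooF.
have xsF : feasible xs.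
  have sum0 : (fun k => \sum_i x k i 0) = fun=> 0.
    by apply/funext => k; exact: run_feasible hrun k.
  apply: (@cvg_unique _ (@norm_hausdorff _ _) ((\sum_i x k i 0) @[k --> F])).
    exact: cvg_sumr.
  by rewrite sum0; exact: cvg_cst.
(* The value at [xs] is at most [f (x 1)], hence below the value at 0. *)
have xs0 : xs != 0.
  apply/eqP => xs0; have := run_pt1_lt hrun.
  rewrite (run_pt0 hrun) -xs0 fxs ltNge => /negP; apply.
  exact: (run_objective_lim_le hlam hrun 1).
have [D D0 disp] := run_displacement hlam hrun hconv.
pose dec k := D * Num.sqrt (f (x k) - f (x k.+1)).
have dec0 : dec k @[k --> \oo] --> 0.
  rewrite -(mulr0 D) -[X in _ --> D * X]sqrtr0 -[X in Num.sqrt X](subrr (limn (f \o x))).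
  apply: cvgM; first exact: cvg_cst.
  have cv : (f (x k) - f (x k.+1)) @[k --> \oo] --> limn (f \o x) - limn (f \o x).
    apply: cvgB; first exact: (run_objective_cvg hlam hrun).
    by have := run_objective_cvg hlam hrun; rewrite -cvg_shiftS.
  exact: (cvg_comp _ _ cv (@sqrt_continuous R _)).
(* The shift [d] selects the bound of iteration [k] or, with [S], that of the sweep following it. *)
have close (u v : nat -> 'cV[R]_n) (d : nat -> nat) : (forall i, u k i 0 @[k --> F] --> xs i 0) ->
    (\oo `<=` d k @[k --> F]) ->
    (\forall k \near F, norm1 (v k - u k) <= dec (d k)) ->
    forall i, v k i 0 @[k --> F] --> xs i 0.
  move=> cu dF vu i.
  have decF : dec (d k) @[k --> F] --> 0 by apply: cvg_trans dec0 => V; exact: dF.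
  have v0 : (v k i 0 - u k i 0) @[k --> F] --> 0.
    apply: norm_cvg0; apply: (squeeze_cvgr _ (cvg_cst 0) decF).
    apply: filterS vu => k vuk; rewrite normr_ge0 /=.
    by apply: le_trans vuk; have := norm1_coord_le (v k - u k) i; rewrite !mxE.
  have -> : (fun k => v k i 0) = (fun k => u k i 0 + (v k i 0 - u k i 0)).
    by apply/funext => k; rewrite addrC subrK.
  by rewrite -[xs i 0]addr0; apply: cvgD.
have cvx1 : forall i, x k.+1 i 0 @[k --> F] --> xs i 0.
  apply: (close x _ id) => //; apply: filterS (FK 1%N) => k k0.
  by have [] := disp k k0.
have S_oo : \oo `<=` (k.+1 @[k --> F]).
  by move=> V [N _ HN]; apply: filterS (FK N) => k Nk; apply: HN; exact: leqW.
have Fac : \forall k \near F, ~~ uses_mvp T k.+1.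
  apply: filterS2 (FK 1%N) Fmvp => -[//|k] _ mvp.
  by rewrite (run_choice hrun) mvp andbF.
have [j Fj] := ultra_finite_fiber (fun k => pivot T k.+1) FU.
(* The pivot rule passes to the limit: [tau] times any entry of [xs] is dominated by the entry at
   [j]. *)
have xsj : xs j 0 != 0.
  have [tau0 _] := andP htau.
  apply: contra xs0 => /eqP xj; apply/eqP/matrixP => i c; rewrite ord1 [RHS]mxE.
  suff : tau * `|xs i 0| <= `|xs j 0|.
    by rewrite xj normr0 pmulr_rle0 // normr_le0 => /eqP.
  apply: (@ler_cvg_to _ F _ _ (fun k => tau * `|x k.+1 i 0|) (fun k => `|x k.+1 j 0|)).
  - by apply: cvgM; [exact: cvg_cst|exact: cvg_norm].
  - exact: cvg_norm.
  apply: filterS2 Fac Fj => k ac <-.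
  have [_ [_ piv] _ _] := run_ac2cd hrun (ltn0Sn k) ac.
  by apply: le_trans piv; rewrite ler_wpM2l ?(ltW tau0) ?norm_coord_le.
(* At the AC2CD iteration k+1 the estimate [mult_est] was computed at x^k. *)
pose N k := nonactive lam (x k.+1) (mult_est T k.+1).
pose nu := gradient A y xs j 0 + lam * Num.sg (xs j 0).
have statN i : (\forall k \near F, i \in N k) -> stationary_at A y lam xs nu i.
  move=> FN; have [->|ij] := eqVneq i j.
    by rewrite /stationary_at (negPf xsj).
  apply: pair_stationary => // t.
  (* The conditions are premises, so [P k] can be met at every [k], by 0 where one of them fails,
     and [choice] applies. *)
  pose P k (z : 'cV[R]_n) := ~~ uses_mvp T k.+1 -> i \in N k -> pivot T k.+1 = j ->
    norm1 (z - x k.+1) <= dec k.+1 /\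
    forall xi, f z <= f (z + xi *: pair_dir i j).
  have [z Hz] : {z : nat -> 'cV[R]_n & forall k, P k (z k)}.
    apply: (@choice _ _ P) => k.
    have [[ac [iN jk]]|no] := pselect (~~ uses_mvp T k.+1 /\ i \in N k /\ pivot T k.+1 = j).
      have [_ /(_ ac i iN) [z z1 z2]] := disp k.+1 (ltn0Sn k).
      by exists z => _ _ _; split=> // xi; rewrite -jk.
    by exists 0 => ac iN jk; case: no.
  have FH : \forall k \near F, norm1 (z k - x k.+1) <= dec k.+1 /\
      forall xi, f (z k) <= f (z k + xi *: pair_dir i j).
    by apply: filterS3 Fac FN Fj => k; exact: Hz.
  have cvz : forall i, z k i 0 @[k --> F] --> xs i 0.
    apply: (close (fun k => x k.+1) z S) => //.
    by apply: filterS FH => k [].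
  apply: (@ler_cvg_to _ F _ _ (fun k => f (z k)) (fun k => f (z k + t *: pair_dir i j))).
  - exact: cvg_objective.
  - apply: cvg_objective => h; rewrite mxE.
    under eq_fun do rewrite mxE.
    by apply: cvgD => //; exact: cvg_cst.
  by apply: filterS FH => k [_].
(* Zero entries of [xs] have weight 0; a nonzero entry is eventually nonzero in [x k.+1], hence
   outside the active set, and [statN] applies. *)
have mu_nu : multiplier A y lam p xs = nu.
  rewrite /multiplier.
  have -> : \sum_i `|xs i 0| `^ p * (grad_phi A y xs i 0 + lam * Num.sg (xs i 0)) =
      nu * \sum_i `|xs i 0| `^ p.
    rewrite mulr_sumr; apply: eq_bigr => i _; rewrite [RHS]mulrC grad_phiE.
    have [->|xi0] := eqVneq (xs i 0) 0.
      by rewrite normr0 powR0 ?gt_eqF // !mul0r.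
    congr (_ * _); apply/eqP.
    have := statN i; rewrite /stationary_at (negPf xi0); apply.
    have xn0 : \forall k \near F, x k.+1 i 0 != 0 by exact: cvgr_neq0 (cvx1 i) xi0.
    by apply: filterS xn0 => k xki; rewrite !inE negb_and xki.
  by rewrite mulfK // gt_eqF // sum_norm_powR_gt0.
exists F, xs; split=> //; first exact: cvg_mx_coord.
apply: (@kkt_optimal _ _ _ _ _ _ hlam xs nu xsF) => i.
(* The ultrafilter decides whether [i] is eventually in [N k]. If not, [x k.+1 i 0 = 0] eventually,
   and the active-set bound, evaluated at [x k], passes to the limit. *)
have [|FnN] := in_ultra_setVsetC [set k | i \in N k] FU; first exact: statN.
have act : \forall k \near F, x k.+1 i 0 = 0 /\
    `|grad_phi A y (x k) i 0 - multiplier A y lam p (x k)| <= lam.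
  apply: filterS3 (filterI FnN Fac) Fmvp (FK 1%N) => k [/= /negP iN ac] mvp k0.
  have [muE _ _ _] := run_mvp hrun k0 mvp.
  have [muE' _ _ _] := run_ac2cd hrun (ltn0Sn k) ac.
  move: iN; rewrite /N !inE negbK muE' /= muE => /andP[/eqP -> ].
  by rewrite [mvp_pi _ _ _ _ _ _ _]mxE.
have xi0 : xs i 0 = 0.
  apply: (@cvg_unique _ (@norm_hausdorff _ _) (x k.+1 i 0 @[k --> F])).
    exact: cvx1.
  by apply: cvg_near_cst; apply: filterS act => k [].
rewrite /stationary_at xi0 eqxx -mu_nu.
apply: (@ler_cvg_to _ F _ _
  (fun k => `|grad_phi A y (x k) i 0 - multiplier A y lam p (x k)|) (fun=> lam)).
- apply: cvg_norm; apply: cvgB; last exact: cvg_multiplier.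
  by under eq_fun do rewrite grad_phiE; exact: cvg_gradient.
- exact: cvg_cst.
by apply: filterS act => k [].
Qed.

End Limit.
Unset Implicit Arguments.
Set Strict Implicit.

Theorem theorem4p6 (R : realType) (m n : nat) (A : 'M[R]_(m, n))
    (y : 'cV[R]_m) (lam p theta tau : R) (T : trace R n)
    (hlam : 0 <= lam) (hp : 0 < p)
    (htheta : 0 < theta <= 1) (htau : 0 < tau <= 1)
    (hrun : AS_ZSL_run A y lam p theta tau T)
    (hconv : forall i j : 'I_n, i != j -> selected_pair T i j ->
       strictly_convex_along A y lam i j) :
  (exists x : 'cV[R]_n, cluster (pt T @ \oo) x) /\
  (forall x : 'cV[R]_n, cluster (pt T @ \oo) x -> optimal A y lam x).
Proof.
have [F [xs [FF ooF cvF [xsF xsopt]]]] :=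
  mvp_limit_optimal hlam hp htheta htau hrun hconv.
(* [F] contains every tail and every preimage of a neighbourhood of [xs], so these intersect. *)
have xs_cl : cluster (pt T @ \oo) xs.
  move=> V W /ooF FV /cvF FW.
  have [k [Vk Wk]] := @filter_ex _ _ FF _ (@filterI _ F _ _ _ FV FW).
  by exists (pt T k).
have value z : cluster (pt T @ \oo) z ->
    objective A y lam z = limn (objective A y lam \o pt T).
  apply: cluster_cvg_value; first exact: objective_continuous.
  exact: (run_objective_cvg hlam hrun).
split=> [|z zcl]; first by exists xs.
split=> [|u uF].
  apply: (@cluster_cvg_value _ _ (pt T @ \oo) (fun u : 'cV[R]_n => \sum_i u i 0)) zcl.
    apply: (cvg_sumr (F := nbhs z) (f := fun i (u : 'cV[R]_n) => u i 0)) => i.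
    exact: coord_continuous.
  have sum0 : (fun k => \sum_i pt T k i 0) = fun=> 0.
    by apply/funext => k; exact: run_feasible hrun k.
  change ((fun k => \sum_i pt T k i 0) k @[k --> \oo] --> (0 : R)).
  by rewrite sum0; exact: cvg_cst.
by rewrite (value z zcl) -(value xs xs_cl); exact: xsopt.
Qed.
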